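(* Let $K$ be a complete discretely valued field of characteristic $p>0$ with perfect residue field. Let $L/K$ be a finite Galois extension with $G=\mathrm{Gal}(L/K)$, and let $v_L$ be the valuation on $L$ normalized so that $v_L(L^\times)=\mathbb{Z}$. Let $\pi_L\in L$ be a prime element (uniformizer) of $L$, let $f(x)\in K[x]$ be the minimal polynomial of $\pi_L$ over $K$, and let $f'(x)$ be its derivative. (1) If $L/K$ is fully (totally) ramified and $[L:K]=p^n$ for some integer $n\ge 0$, then every element $\rho\in L$ with $v_L(\rho)\equiv -v_L(f'(\pi_L))-1 \pmod{[L:K]}$ generates a normal basis for $L/K$, i.e. $K[G]\cdot\rho=L$ (equivalently, $\{\sigma\rho:\sigma\in G\}$ is a $K$-basis of $L$). (2) The hypothesis in (1) is necessary and the criterion is tight: if $L/K$ is not a fully ramified extension of $p$-power degree, then for every $i\in\mathbb{Z}$ there exists $\rho_i\in L$ with $v_L(\rho_i)=i$ and $K[G]\cdot\rho_i\subsetneq L$; and if $L/K$ is fully ramified of degree $p^n$, then for every integer $i\not\equiv -v_L(f'(\pi_L))-1\pmod{[L:K]}$ there exists $\rho_i\in L$ with $v_L(\rho_i)=i$ and $K[G]\cdot\rho_i\subsetneq L$.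
   Context: Here ''complete local field'' means a field complete with respect to a discrete valuation. $K[G]$ is the group algebra acting on $L$ via the Galois action. The polynomial called $p(x)$ in the paper is denoted $f(x)$ here to avoid a clash with the prime $p$; note that $(f'(\pi_L))$ generates the relative different $\mathfrak D_{L/K}$. *)

(* Defs.v *)
From HB Require Import structures.
From mathcomp Require Import all_boot all_order all_fingroup all_algebra.
From mathcomp Require Import all_solvable all_field generic_quotient ring_quotient.

Set Implicit Arguments.
Unset Strict Implicit.
Unset Printing Implicit Defensive.

Import Order.TTheory GRing.Theory Num.Theory.
Local Open Scope ring_scope.

(* The value v 0 (mathematically +oo) is an unspecified integer, so
   every clause, here and below, is guarded by x != 0.  Surjectivity onto int
   is the normalization of v. *)
Record discrete_valuation (F : fieldType) := DiscreteValuation {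
  dval :> F -> int;
  dvalM : forall x y, x != 0 -> y != 0 -> dval (x * y) = dval x + dval y;
  dvalD : forall x y, x != 0 -> y != 0 -> x + y != 0 ->
    Num.min (dval x) (dval y) <= dval (x + y);
  dval_surj : forall i : int, exists2 x, x != 0 & dval x = i
}.

Section Valuation.
Variables (F : fieldType) (v : discrete_valuation F).

(* v(x) >= m, with the convention v(0) = +oo. *)
Definition val_ge (m : int) (x : F) : bool := (x == 0) || (m <= v x).

Definition uniformizer (x : F) : Prop := x != 0 /\ v x = 1.

Definition cauchy (u : nat -> F) : Prop :=
  forall m : int, exists N : nat,
    forall i j : nat, (N <= i)%N -> (N <= j)%N -> val_ge m (u i - u j).

Definition converges_to (u : nat -> F) (l : F) : Prop :=
  forall m : int, exists N : nat,
    forall i : nat, (N <= i)%N -> val_ge m (u i - l).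

Definition val_complete : Prop :=
  forall u : nat -> F, cauchy u -> exists l : F, converges_to u l.

Lemma dval1 : v 1 = 0.
Proof.
have := dvalM v (oner_neq0 F) (oner_neq0 F); rewrite mulr1 => /esym/eqP.
by rewrite -subr_eq0 addrK => /eqP.
Qed.

Lemma dvalN x : x != 0 -> v (- x) = v x.
Proof.
move=> x0; have n1 : -1 != 0 :> F by rewrite oppr_eq0 oner_eq0.
have := dvalM v n1 n1; rewrite mulrNN mulr1 dval1 => /esym/eqP.
rewrite -mulr2n mulrn_eq0 /= => /eqP vN1.
by rewrite -mulN1r dvalM // vN1 add0r.
Qed.

Lemma dvalV x : x != 0 -> v x^-1 = - v x.
Proof.
move=> x0; have xV0 : x^-1 != 0 by rewrite invr_eq0.
have := dvalM v x0 xV0; rewrite divff // dval1 => /esym/eqP.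
by rewrite addrC addr_eq0 => /eqP.
Qed.

Lemma val_ge0 m : val_ge m 0.
Proof. by rewrite /val_ge eqxx. Qed.

Lemma val_geB m x y : val_ge m x -> val_ge m y -> val_ge m (x - y).
Proof.
rewrite /val_ge; have [-> _|x0 /= mx] := eqVneq x 0.
  by rewrite sub0r oppr_eq0; case: eqVneq => //= y0; rewrite dvalN.
have [-> _|y0 /= my] := eqVneq y 0; first by rewrite subr0 mx orbT.
have [//|xy0 /=] := eqVneq (x - y) 0.
apply: le_trans (dvalD v x0 _ xy0); last by rewrite oppr_eq0.
by rewrite dvalN // le_min mx.
Qed.

Lemma val_geM m n x y : val_ge m x -> val_ge n y -> val_ge (m + n) (x * y).
Proof.
rewrite /val_ge mulf_eq0; case: eqVneq => //= x0 mx.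
by case: eqVneq => //= y0 ny; rewrite dvalM // lerD.
Qed.

Definition valuation_ring : {pred F} := val_ge 0.

Fact valuation_ring_subring : subring_closed valuation_ring.
Proof.
split=> [|x y|x y]; rewrite ?unfold_in /=.
- by rewrite /valuation_ring /val_ge dval1 lexx orbT.
- exact: val_geB.
- by move=> x0 y0; have := val_geM x0 y0; rewrite addr0.
Qed.

HB.instance Definition _ :=
  GRing.isSubringClosed.Build F valuation_ring valuation_ring_subring.

Record val_int := ValInt { val_int_val : F; _ : val_int_val \in valuation_ring }.

HB.instance Definition _ := [isSub for val_int_val].
HB.instance Definition _ := [Choice of val_int by <:].
HB.instance Definition _ := [SubChoice_isSubComNzRing of val_int by <:].

Definition maximal_ideal : {pred val_int} := fun x => val_ge 1 (val x).

Fact maximal_ideal_idealr : idealr_closed maximal_ideal.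
Proof.
split; rewrite ?unfold_in /maximal_ideal.
- by rewrite raddf0 val_ge0.
- by rewrite rmorph1 /val_ge oner_eq0 dval1.
- move=> a x y; rewrite !unfold_in /maximal_ideal => mx my.
  rewrite rmorphD rmorphM.
  have mNy : val_ge 1 (- val y) by rewrite -sub0r val_geB ?val_ge0.
  have := val_geB (val_geM (valP a) mx) mNy.
  by rewrite add0r opprK.
Qed.

HB.instance Definition _ :=
  isIdealr.Build val_int maximal_ideal maximal_ideal_idealr.

Definition residue_field : Type := {ideal_quot maximal_ideal}.

HB.instance Definition _ := GRing.ComNzRing.on residue_field.

Local Open Scope quotient_scope.

Definition residue_class (x : val_int) : residue_field :=
  \pi_{ideal_quot maximal_ideal} x.

Lemma residue_class_eq0 x : (residue_class x == 0) = (x \in maximal_ideal).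
Proof.
have -> : 0 = residue_class 0 by rewrite /residue_class raddf0.
by rewrite /residue_class -Quotient.idealrBE subr0.
Qed.

Lemma res_inv_subproof (x : val_int) : x \notin maximal_ideal ->
  (val x)^-1 \in valuation_ring.
Proof.
have := valP x; rewrite !unfold_in /maximal_ideal /valuation_ring /val_ge.
case: eqVneq => //= x0 vx; rewrite invr_eq0 (negPf x0) dvalV //=.
by rewrite -ltNge oppr_ge0 -[1]add0r ltzD1.
Qed.

Definition residue_lift (a : residue_field) : val_int :=
  generic_quotient.repr (a : {ideal_quot maximal_ideal}).

Lemma residue_liftK a : residue_class (residue_lift a) = a.
Proof. exact: reprK. Qed.

Definition res_inv (a : residue_field) : residue_field :=
  if a == 0 then 0
  else residue_class (insubd (0 : val_int) (val (residue_lift a))^-1).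

Fact res_mulVf (a : residue_field) : a != 0 -> res_inv a * a = 1.
Proof.
move=> a0; rewrite /res_inv (negPf a0).
have ra := residue_liftK a.
have nI : residue_lift a \notin maximal_ideal.
  by rewrite -residue_class_eq0 ra.
rewrite -{2}ra /residue_class -rmorphM /=.
rewrite -[RHS](rmorph1 (\pi_{ideal_quot maximal_ideal})).
congr (\pi _); apply: val_inj; rewrite rmorphM rmorph1 /= insubdK.
  rewrite mulVf //; apply: contraNneq nI => r0.
  by rewrite unfold_in /maximal_ideal /= r0 val_ge0.
exact: res_inv_subproof.
Qed.

Fact res_inv0 : res_inv 0 = 0.
Proof. by rewrite /res_inv eqxx. Qed.

HB.instance Definition _ :=
  GRing.ComNzRing_isField.Build residue_field res_mulVf res_inv0.

End Valuation.

Definition perfect_field (k : fieldType) : Prop :=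
  forall q : {poly k}, irreducible_poly q -> separable_poly q.

Section Extension.
Variables (K : fieldType) (L : splittingFieldType K).

(* vK and vL are both normalized, so "vL extends vK" means that vL restricted
   to K is e times vK, where e > 0 is the ramification index. *)
Definition ramification_index (vK : discrete_valuation K)
    (vL : discrete_valuation L) (e : nat) : Prop :=
  forall x : K, x != 0 -> vL x%:A = e%:Z * vK x.

Definition val_extends (vK : discrete_valuation K)
    (vL : discrete_valuation L) : Prop :=
  exists2 e : nat, (0 < e)%N & ramification_index vK vL e.

(* \dim {:L} is the degree [L : K]. *)
Definition fully_ramified (vK : discrete_valuation K)
    (vL : discrete_valuation L) : Prop :=
  ramification_index vK vL (\dim {:L}).

Definition galois_conjugates (x : L) : seq L :=
  [seq (s : gal_of {:L}) x | s <- enum 'Gal({:L} / 1)%g].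

(* The element \sum_s a_s s of K[G] acting on x; coefficients of a outside
   G = 'Gal({:L} / 1) play no role. *)
Definition group_algebra_act (a : {ffun gal_of {:L} -> K}) (x : L) : L :=
  \sum_(s in 'Gal({:L} / 1)%g) a s *: (s : gal_of {:L}) x.

Definition in_KG_orbit (rho y : L) : Prop :=
  exists a : {ffun gal_of {:L} -> K}, y = group_algebra_act a rho.

Definition generates_KG (rho : L) : Prop := forall y : L, in_KG_orbit rho y.

Definition normal_basis_generator (rho : L) : Prop :=
  basis_of {:L} (galois_conjugates rho).

End Extension.

(* Main.v *)
Require Import Defs.
From mathcomp Require Import all_boot all_order all_fingroup all_algebra.
From mathcomp Require Import all_solvable all_field.
From mathcomp Require Import mxrepresentation mxabelem zify.
From Stdlib Require Import Classical_Prop.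

(** A relation among the conjugates of rho is a nonzero annihilator of rho in
    K[G], and by a dimension count rho generates L over K[G] iff there is none.

    Suppose L/K is fully ramified of degree N, with uniformizer pi and
    f = minPoly 1 pi.  By Euler, Tr(pi^j / f'(pi)) is 0 for j < N - 1 and 1 for
    j = N - 1.  Expanding rho f'(pi) in powers of pi, whose terms have distinct
    valuations modulo N, shows that v(rho) = -v(f'(pi)) - 1 mod N forces
    Tr rho <> 0, while every other residue class contains elements of trace 0.
    If G is a p-group, the left annihilator of rho, when nonzero, contains the
    norm element of K[G], so Tr rho <> 0 suffices for rho to generate.

    If e < N, completeness yields a unit u that no element of K approximates
    modulo the maximal ideal; two elements r and u r then have a K-combination
    of trace 0 and of the same valuation.  If e = N is not a power of p, take s in G
    of prime order q <> p; it has an eigenvector w of valuation 1 whose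
    eigenvalue z in K is a q-th root of unity, and s - z^i kills w^i. *)

Set Implicit Arguments.
Unset Strict Implicit.
Unset Printing Implicit Defensive.

Import Order.TTheory GRing.Theory Num.Theory.
Local Open Scope ring_scope.

Lemma ge_min_int (m n k : int) : Num.min m n <= k -> m <= k \/ n <= k.
Proof. by rewrite ge_min => /orP. Qed.

(** * Arithmetic of discrete valuations *)

Section DiscreteValuation.
Variables (F : fieldType) (v : discrete_valuation F).
Implicit Types (x y : F) (m : int) (n : nat).

Lemma val_ge_neq0 m x : x != 0 -> val_ge v m x = (m <= v x).
Proof. by rewrite /val_ge => /negPf->. Qed.

Lemma val_ge_trans m (m' : int) x : m <= m' -> val_ge v m' x -> val_ge v m x.
Proof. by rewrite /val_ge => mn /predU1P[->|/(le_trans mn) ->]; rewrite ?eqxx ?orbT. Qed.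

Lemma val_ge_id x : val_ge v (v x) x.
Proof. by rewrite /val_ge lexx orbT. Qed.

Lemma val_geN m x : val_ge v m x -> val_ge v m (- x).
Proof. by rewrite -sub0r; apply: val_geB; rewrite val_ge0. Qed.

Lemma val_geD m x y : val_ge v m x -> val_ge v m y -> val_ge v m (x + y).
Proof. by move=> mx my; rewrite -[y]opprK val_geB ?val_geN. Qed.

Lemma val_ge_sum m (I : Type) (r : seq I) (P : pred I) (E : I -> F) :
  (forall i, P i -> val_ge v m (E i)) -> val_ge v m (\sum_(i <- r | P i) E i).
Proof. by move=> mE; elim/big_ind: _ => //; [apply: val_ge0 | apply: val_geD]. Qed.

Lemma val_ge_all_eq0 x : (forall m, val_ge v m x) -> x = 0.
Proof.
move=> vx; apply/eqP; case: eqVneq => // x0; have := vx (v x + 1).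
by rewrite val_ge_neq0 //; lia.
Qed.

(** The upper bound comes from the ultrametric inequality applied to x = (x + y) - y, since y alone
    has too large a valuation to attain that of x. *)
Lemma dvalDl x y : x != 0 -> val_ge v (v x + 1) y ->
  x + y != 0 /\ v (x + y) = v x.
Proof.
move=> x0; have [-> _|y0] := eqVneq y 0; first by rewrite addr0.
rewrite val_ge_neq0 // => vy.
have xy0 : x + y != 0.
  by apply: contraTneq vy => /eqP; rewrite addr_eq0 => /eqP->; rewrite dvalN //; lia.
split=> //; have Ny0 : - y != 0 by rewrite oppr_eq0.
have := dvalD v xy0 Ny0; rewrite addrK dvalN // => /(_ x0).
have := dvalD v x0 y0 xy0; have [z <-] : exists z, z = x + y by exists (x + y).
by do 2![case/ge_min_int=> ?]; lia.
Qed.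

Lemma dvalX x n : x != 0 -> v (x ^+ n) = v x *+ n.
Proof.
move=> x0; elim: n => [|n IH]; first by rewrite dval1.
by rewrite exprS mulrS dvalM ?expf_neq0 // IH.
Qed.

Lemma dvalXz x m : x != 0 -> v (x ^ m) = v x * m.
Proof.
move=> x0; case: (intP m) => [|n|n]; first by rewrite expr0z dval1 mulr0.
  by rewrite -exprnP dvalX // -mulr_natr natz.
by rewrite -invr_expz dvalV ?expfz_neq0 // -exprnP dvalX // -mulr_natr natz mulrN.
Qed.

Lemma val_geX m x n : val_ge v m x -> val_ge v (m *+ n) (x ^+ n).
Proof.
move=> mx; elim: n => [|n IH]; first by rewrite /val_ge dval1 mulr0n lexx orbT.
by rewrite exprS mulrS val_geM.
Qed.

Lemma val_ge0X x n : val_ge v 0 x -> val_ge v 0 (x ^+ n).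
Proof. by move=> x0; have := val_geX n x0; rewrite mul0rn. Qed.

(** With pairwise distinct valuations, the term of least valuation strictly dominates the sum of all
    the others. *)
Lemma dval_sum_distinct (I : finType) (E : I -> F) (i0 : I) :
  (forall i j, E i != 0 -> E j != 0 -> v (E i) = v (E j) -> i = j) ->
  E i0 != 0 ->
  exists i, [/\ E i != 0, \sum_i E i != 0, v (\sum_i E i) = v (E i)
             & forall j, E j != 0 -> v (E i) <= v (E j)].
Proof.
move=> Einj Ei0.
have [i Ei mini] :=
  @Order.TotalTheory.arg_minP _ _ _ i0 [pred i | E i != 0] (fun i => v (E i)) Ei0.
exists i; have rest : val_ge v (v (E i) + 1) (\sum_(j | j != i) E j).
  apply: val_ge_sum => j ji; have [->|Ej] := eqVneq (E j) 0; first exact: val_ge0.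
  rewrite val_ge_neq0 //; have := mini j Ej; have : v (E i) <> v (E j).
    by move/(Einj _ _ Ei Ej)=> ij; rewrite ij eqxx in ji.
  lia.
by rewrite (bigD1 i) //=; case: (dvalDl Ei rest) => -> ->.
Qed.

End DiscreteValuation.

(** * Combinations of powers of a uniformizer below the ramification index *)

Section RamifiedPowers.
Variables (K : fieldType) (L : splittingFieldType K).
Variables (vK : discrete_valuation K) (vL : discrete_valuation L).
Variables (e : nat) (ram : ramification_index vK vL e).
Variables (pi : L) (pi_unif : uniformizer vL pi).

Lemma algK_neq0 (a : K) : (a%:A != 0 :> L) = (a != 0).
Proof. by rewrite scaler_eq0 oner_eq0 orbF. Qed.

Lemma dvalZ (a : K) (y : L) : a != 0 -> y != 0 ->
  vL (a *: y) = e%:Z * vK a + vL y.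
Proof. by move=> a0 y0; rewrite -mulr_algl dvalM ?algK_neq0 // ram. Qed.

Lemma val_ge_alg m (a : K) : val_ge vK m a -> val_ge vL (e%:Z * m) (a%:A : L).
Proof.
have [->|a0] := eqVneq a 0; first by rewrite scale0r !val_ge0.
by rewrite !val_ge_neq0 ?algK_neq0 // ram //; nia.
Qed.

Lemma dval_unifX n : vL (pi ^+ n) = n%:Z.
Proof. by case: pi_unif => pi0 vpi; rewrite dvalX // vpi -mulr_natr mul1r natz. Qed.

Lemma unifX_neq0 n : pi ^+ n != 0.
Proof. by rewrite expf_neq0 //; case: pi_unif. Qed.

(** The term of index i has valuation congruent to i modulo e, and i < e, so no two nonzero terms
    share a valuation. *)
Lemma dval_power_sum (a : 'I_e -> K) (j0 : 'I_e) : a j0 != 0 ->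
  let S := \sum_i a i *: pi ^+ i in
  exists i, [/\ a i != 0, S != 0, vL S = e%:Z * vK (a i) + i%:Z
             & forall j, a j != 0 ->
                 e%:Z * vK (a i) + i%:Z <= e%:Z * vK (a j) + j%:Z].
Proof.
move=> aj0 S; pose E i := a i *: pi ^+ (i : 'I_e).
have E0 i : (E i != 0) = (a i != 0).
  by rewrite scaler_eq0 negb_or unifX_neq0 andbT.
have vE i : a i != 0 -> vL (E i) = e%:Z * vK (a i) + i%:Z.
  by move=> ai; rewrite dvalZ ?unifX_neq0 // dval_unifX.
have Einj i j : E i != 0 -> E j != 0 -> vL (E i) = vL (E j) -> i = j.
  rewrite !E0 => ai aj; rewrite !vE // => /(congr1 (fun z => (z %% e)%Z)).
  rewrite ![e%:Z * _]mulrC !modzMDl !modz_small;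
    by [move=> [/val_inj] | case: (i) | case: (j)].
have [|i [Ei S0 vS mini]] := dval_sum_distinct Einj (i0 := j0); first by rewrite E0.
exists i; rewrite E0 in Ei; split=> //; first by rewrite vS vE.
by move=> j aj; rewrite -!vE // mini // E0.
Qed.

Lemma val_ge_power_sum (a : 'I_e -> K) (j : 'I_e) m :
  val_ge vL m (\sum_i a i *: pi ^+ i) -> a j != 0 -> m <= e%:Z * vK (a j) + j%:Z.
Proof.
move=> mS aj; have [i [ai S0 vS /(_ j aj)]] := dval_power_sum aj.
by rewrite val_ge_neq0 // vS in mS; apply: le_trans.
Qed.

Lemma power_sum_eq0 (a : 'I_e -> K) :
  \sum_i a i *: pi ^+ i = 0 -> forall i, a i = 0.
Proof.
move=> S0 i; apply/eqP; case: eqVneq => // ai.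
by have [j [_ /eqP]] := dval_power_sum ai.
Qed.

Lemma free_powers : free [tuple pi ^+ i | i < e].
Proof.
apply/freeP => a; under eq_bigr => i _ do rewrite -tnth_nth tnth_mktuple.
exact: power_sum_eq0.
Qed.

Lemma ramification_le_dim : (e <= \dim {:L})%N.
Proof.
by have := free_powers; rewrite /free size_tuple => /eqP <-; apply: dimvS (subvf _).
Qed.

Lemma dim_le_ramification :
  (forall x : L, exists a : 'I_e -> K, x = \sum_i a i *: pi ^+ i) ->
  (\dim {:L} <= e)%N.
Proof.
move=> span_pi; rewrite -[leqRHS](size_tuple [tuple pi ^+ i | i < e]).
apply: leq_trans (dim_span _); apply: dimvS; apply/subvP=> x _.
have [a ->] := span_pi x; apply: rpred_sum => i _; apply: rpredZ.
by apply: memv_span; apply/mapP; exists i; rewrite ?mem_enum.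
Qed.

End RamifiedPowers.

(** * Galois conjugation preserves integrality when e = N *)

Section FullyRamified.
Variables (K : fieldType) (L : splittingFieldType K).
Variables (vK : discrete_valuation K) (vL : discrete_valuation L).
Hypothesis ramL : fully_ramified vK vL.
Variables (pi : L) (pi_unif : uniformizer vL pi).
Let N := \dim {:L}.

Lemma fully_ramified_power_sum (x : L) :
  exists a : 'I_N -> K, x = \sum_i a i *: pi ^+ i.
Proof.
have bas : basis_of {:L} [tuple pi ^+ i | i < N].
  rewrite basisEfree (free_powers ramL pi_unif) subvf size_tuple leqnn andbT //=.
exists (fun i => coord [tuple pi ^+ i | i < N] i x).
rewrite {1}(coord_basis bas (memvf x)); apply: eq_bigr => i _.
by rewrite -tnth_nth tnth_mktuple.
Qed.

(* The conjugates of the powers of pi bound [s x] below on the valuation ring;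
   applied to the powers of [x], the bound becomes 0. *)
Lemma val_ge0_conj (s : gal_of {:L}) (x : L) : val_ge vL 0 x -> val_ge vL 0 (s x).
Proof.
pose mu := \big[Order.min/0]_(i < N) vL (s (pi ^+ i)).
have mu_le i : (mu <= vL (s (pi ^+ (i : 'I_N)))) by apply: bigmin_le_cond.
have bound y : val_ge vL 0 y -> val_ge vL mu (s y).
  have [a ->] := fully_ramified_power_sum y => vy.
  rewrite linear_sum; apply: val_ge_sum => i _; rewrite linearZ /=.
  have [->|ai] := eqVneq (a i) 0; first by rewrite scale0r val_ge0.
  (* From N * vK (a i) + i >= 0 and i < N. *)
  have ai0 : 0 <= vK (a i).
    by have := val_ge_power_sum ramL pi_unif vy ai; have := ltn_ord i; rewrite -/N; nia.
  have s0 : s (pi ^+ i) != 0 by rewrite fmorph_eq0 (unifX_neq0 pi_unif).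
  rewrite val_ge_neq0 ?scaler_eq0 ?negb_or ?ai // (dvalZ ramL) // ler_wpDl //.
  by rewrite mulr_ge0.
move=> vx; have [->|sx0] := eqVneq (s x) 0; first exact: val_ge0.
rewrite val_ge_neq0 //; case: lerP => // neg.
(* If [s x] had valuation at most -1, the conjugate of this power would have valuation at most -|mu|
   - 1 < mu. *)
have vxn : val_ge vL 0 (x ^+ `|mu|.+1).
  exact: val_ge0X.
have := bound _ vxn; rewrite rmorphXn /= val_ge_neq0 ?expf_neq0 // dvalX //.
by rewrite -mulr_natr natz; nia.
Qed.

End FullyRamified.

Lemma gal_alg (K : fieldType) (L : splittingFieldType K) (s : gal_of {:L}) (a : K) :
  s a%:A = a%:A.
Proof. by rewrite linearZ /= rmorph1. Qed.

(** * Invariance of the valuation, and triviality of the residue extension *)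

Section FullyRamifiedConjugates.
Variables (K : fieldType) (L : splittingFieldType K).
Variables (vK : discrete_valuation K) (vL : discrete_valuation L).
Hypothesis ramL : fully_ramified vK vL.
Variables (pi : L) (pi_unif : uniformizer vL pi).
Let N := \dim {:L}.

Let N_gt0 : (0 < N)%N. Proof. exact: adim_gt0. Qed.

(** Units suffice: if [vK a = vL x], full ramification makes x^N / a a unit, and s fixes [a].
    Integrality of the conjugates of this unit and of its inverse forces valuation 0. *)
Lemma dval_conj (s : gal_of {:L}) (x : L) : x != 0 -> vL (s x) = vL x.
Proof.
move=> x0; have [a a0 va] := dval_surj vK (vL x).
have aL : a^-1%:A != 0 :> L by rewrite scaler_eq0 oner_eq0 orbF invr_eq0.
have sx0 : s x != 0 by rewrite fmorph_eq0.
pose y := x ^+ N * a^-1%:A.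
have y0 : y != 0 by rewrite mulf_neq0 ?expf_neq0.
have vaN : vL a^-1%:A = - (N%:Z * vL x) by rewrite ramL ?invr_eq0 // dvalV // va mulrN.
have vy : vL y = 0.
  by rewrite dvalM ?expf_neq0 // dvalX // vaN -mulr_natl natz subrr.
have sy0 : s y != 0 by rewrite fmorph_eq0.
have := val_ge0_conj ramL pi_unif s (x := y).
rewrite !val_ge_neq0 // vy => /(_ isT) le1.
have := val_ge0_conj ramL pi_unif s (x := y^-1).
rewrite fmorphV !val_ge_neq0 ?invr_eq0 // !dvalV // vy oppr0 => /(_ isT) le2.
have : vL (s y) = 0 by apply/eqP; rewrite eq_le le1 andbT -oppr_ge0.
have -> : s y = s x ^+ N * a^-1%:A by rewrite rmorphM rmorphXn; congr (_ * _); apply: gal_alg.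
rewrite dvalM ?expf_neq0 // dvalX // vaN -mulr_natl natz.
move/eqP; rewrite subr_eq0 => /eqP /mulfI; apply; move: N_gt0; lia.
Qed.

Lemma val_ge_conj m (s : gal_of {:L}) (x : L) : val_ge vL m x -> val_ge vL m (s x).
Proof.
have [->|x0] := eqVneq x 0; first by rewrite rmorph0.
by rewrite !val_ge_neq0 ?fmorph_eq0 // dval_conj.
Qed.

(** The constant coefficient of u in powers of pi works: a term of index 0 < i < N with nonnegative
    valuation has an integral coefficient, hence valuation at least 1. *)
Lemma fully_ramified_residue (u : L) : val_ge vL 0 u ->
  exists a : K, val_ge vL 1 (u - a%:A).
Proof.
have [a ->] := fully_ramified_power_sum ramL pi_unif u => vu.
exists (a (Ordinal N_gt0)); rewrite (bigD1 (Ordinal N_gt0)) //= addrC.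
rewrite expr0 addrK; apply: val_ge_sum => i ni.
have [->|ai] := eqVneq (a i) 0; first by rewrite scale0r val_ge0.
have := val_ge_power_sum ramL pi_unif vu ai.
rewrite val_ge_neq0 ?scaler_eq0 ?negb_or ?ai ?(unifX_neq0 pi_unif) //.
rewrite (dvalZ ramL) ?(unifX_neq0 pi_unif) // (dval_unifX pi_unif).
have i0 : (0 < i)%N by rewrite lt0n; apply: contra ni => /eqP i0; apply/eqP/val_inj.
have := ltn_ord i; rewrite -/N; case: (lerP 0 (vK (a i))); nia.
Qed.

End FullyRamifiedConjugates.

(** * Completeness and trivial residue extension: the powers of pi span L *)

Section TrivialResidueExtension.
Variables (K : fieldType) (L : splittingFieldType K).
Variables (vK : discrete_valuation K) (vL : discrete_valuation L).
Hypothesis K_complete : val_complete vK.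
Variables (e : nat) (e_gt0 : (0 < e)%N) (ram : ramification_index vK vL e).
Variables (pi : L) (pi_unif : uniformizer vL pi).
Hypothesis residue_trivial :
  forall u : L, vL u = 0 -> exists t : K, val_ge vL 1 (u - t%:A).

Let power_sum (c : {ffun 'I_e -> K}) : L := \sum_i c i *: pi ^+ i.

Let power_sumB (c d : {ffun 'I_e -> K}) :
  power_sum [ffun i => c i - d i] = power_sum c - power_sum d.
Proof.
by rewrite -sumrB; apply: eq_bigr => i _; rewrite ffunE scalerBl.
Qed.

(** Successive approximation: write the valuation of the remainder z as e * v(b) + r with r < e.
    Then z / (b pi^r) is a unit, and subtracting its residue representative t times b pi^r gains at
    least one unit of valuation. *)
Lemma power_sum_approx m (x : L) (k : nat) : val_ge vL m x ->
  exists c : {ffun 'I_e -> K}, val_ge vL (m + k%:Z) (x - power_sum c).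
Proof.
move=> vx; elim: k => [|k [c vz]].
  exists 0; rewrite addr0 /power_sum big1 ?subr0 // => i _.
  by rewrite ffunE scale0r.
have [z0|z0] := eqVneq (x - power_sum c) 0.
  by exists c; rewrite z0 val_ge0.
move: vz z0; set z := x - power_sum c => vz z0; rewrite val_ge_neq0 // in vz.
have ep : 0 < e%:Z by lia.
have e0 : e%:Z != 0 by lia.
have lt_r : (`|(vL z %% e)%Z| < e)%N.
  by have := ltz_pmod (vL z) ep; have := modz_ge0 (vL z) e0; lia.
pose r := Ordinal lt_r.
have vzE : vL z = (vL z %/ e)%Z * e%:Z + r%:Z.
  by rewrite {1}(divz_eq (vL z) e) /= gez0_abs // modz_ge0.
have [b b0 vb] := dval_surj vK (vL z %/ e)%Z.
have w0 : b *: pi ^+ r != 0 by rewrite scaler_eq0 negb_or b0 (unifX_neq0 pi_unif).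
have vw : vL (b *: pi ^+ r) = vL z.
  by rewrite (dvalZ ram) ?(unifX_neq0 pi_unif) // (dval_unifX pi_unif) vb [RHS]vzE mulrC.
have vu : vL (z / (b *: pi ^+ r)) = 0.
  by rewrite dvalM ?invr_eq0 // dvalV // vw subrr.
have [t vt] := residue_trivial vu.
exists [ffun i => c i + (t * b) *+ (i == r)].
have -> : power_sum [ffun i => c i + (t * b) *+ (i == r)]
          = power_sum c + t *: (b *: pi ^+ r).
  rewrite /power_sum (eq_bigr (fun i => c i *: pi ^+ i +
    (if i == r then t *: (b *: pi ^+ r) else 0))).
    by rewrite big_split /= -big_mkcond big_pred1_eq.
  move=> i _; rewrite ffunE scalerDl; case: eqP => [->|_]; last by rewrite scale0r.
  by rewrite mulr1n scalerA.
rewrite opprD addrA -/z.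
have -> : z - t *: (b *: pi ^+ r) = (z / (b *: pi ^+ r) - t%:A) * (b *: pi ^+ r).
  by rewrite mulrBl divfK // mulr_algl.
have := val_geM vt (val_ge_id vL (b *: pi ^+ r)); rewrite vw.
by apply: val_ge_trans; lia.
Qed.

(** The coefficients of the approximations form Cauchy sequences in K; their limits are the
    coefficients of x. *)
Lemma power_sum_complete (x : L) : exists a : 'I_e -> K, x = \sum_i a i *: pi ^+ i.
Proof.
have [|x0] := eqVneq x 0.
  by move->; exists (fun=> 0); rewrite big1 // => i _; rewrite scale0r.
pose m := vL x.
have app (k : nat) := power_sum_approx k (val_ge_id vL x).
pose c k := xchoose (app k).
have cP k : val_ge vL (m + k%:Z) (x - power_sum (c k)) := xchooseP (app k).
(* The extra summand e absorbs the exponent i < e when a bound on the power sum is turned into one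
   on its i-th coefficient. *)
have cauchy_c i : cauchy vK (fun k => c k i).
  move=> M; exists (absz (e%:Z * M + e%:Z - m)%R) => j k jM kM.
  have [->|cjk] := eqVneq (c j i - c k i) 0; first exact: val_ge0.
  rewrite val_ge_neq0 //.
  have vs : val_ge vL (e%:Z * M + e%:Z) (power_sum [ffun i => c j i - c k i]).
    rewrite power_sumB.
    have -> : power_sum (c j) - power_sum (c k)
      = (x - power_sum (c k)) - (x - power_sum (c j)).
      by rewrite [RHS]addrC opprB addrA subrK.
    by apply: val_geB; [apply: val_ge_trans (cP k)|apply: val_ge_trans (cP j)]; lia.
  have := val_ge_power_sum ram pi_unif vs (j := i); rewrite ffunE => /(_ cjk).
  by have := ltn_ord i; nia.
have [l lP] := fin_all_exists (fun i => K_complete (cauchy_c i)).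
exists l; apply/eqP; rewrite -subr_eq0; apply/eqP/(@val_ge_all_eq0 _ vL) => M.
(* The absolute value matters for negative M: e * |M| >= M always holds, whereas e * M >= M may
   fail. *)
have [n nP] := fin_all_exists (fun i => lP i `|M|).
pose k := (absz (M - m)%R + \max_i n i)%N.
have -> : x - \sum_i l i *: pi ^+ i
          = (x - power_sum (c k)) + \sum_i (c k i - l i) *: pi ^+ i.
  have -> : \sum_i (c k i - l i) *: pi ^+ i = power_sum (c k) - \sum_i l i *: pi ^+ i.
    by rewrite -sumrB; apply: eq_bigr => i _; rewrite scalerBl.
  by rewrite addrA subrK.
apply: val_geD; first by apply: val_ge_trans (cP k); rewrite /k; lia.
apply: val_ge_sum => i _.
have := nP i k (leq_trans (leq_bigmax i) (leq_addl _ _)).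
have [->|ci] := eqVneq (c k i - l i) 0; first by rewrite scale0r !val_ge0.
rewrite !val_ge_neq0 ?scaler_eq0 ?negb_or ?ci ?(unifX_neq0 pi_unif) //.
rewrite (dvalZ ram) ?(unifX_neq0 pi_unif) // (dval_unifX pi_unif).
by have : (0 : int) <= i by []; nia.
Qed.

End TrivialResidueExtension.

(** * The regular representation of a p-group in characteristic p *)

Section RegularRepresentation.
Variables (F : fieldType) (gT : finGroupType) (G : {group gT}).
Variables (p : nat) (charF : p \in [pchar F]) (pG : (p.-group G)%g).

(* The socle of F[G] is the line spanned by the norm element. *)
Lemma pgroup_regular_submod (U : 'M[F]_#|G|) :
  mxmodule (regular_repr F G) U -> U != 0 ->
  ((const_mx 1 : 'rV_#|G|) <= U)%MS.
Proof.
move=> modU U0.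
(* A p-group acting on a nonzero space in characteristic p has a nonzero fixed vector. *)
pose W := (U :&: rfix_mx (regular_repr F G) G)%MS.
have : W != 0.
  rewrite /W -(in_submodK (capmxSl _ _)) val_submod_eq0 -submx0.
  rewrite -(rfix_submod modU) // submx0 (rfix_pgroup_pchar charF _ _ pG) //.
  by rewrite lt0n mxrank_eq0.
rewrite -submx0; case/row_subPn => i0; rewrite submx0.
move: (row i0 W) (row_sub i0 W) => v vW v0.
have vU : (v <= U)%MS := submx_trans vW (capmxSl _ _).
have /rfix_mxP vfix := submx_trans vW (capmxSr _ _).
pose c := v 0 (gring_index G 1).
(* Invariance under x, read at the coordinate x, returns the coordinate at 1. *)
have v_const x : x \in G -> v 0 (gring_index G x) = c.
  move=> Gx; rewrite -{1}(vfix x Gx) mxE (bigD1 (gring_index G 1)) //=.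
  rewrite !mxE gring_indexK ?group1 // mul1g !eqxx mulr1 big1 ?addr0 // => i ni.
  rewrite !mxE eqxx /=; case: eqP => [/esym E|_]; last by rewrite mulr0.
  move: E => /(can_in_inj (@gring_indexK _ G)); rewrite groupMl ?enum_valP // => /(_ Gx Gx).
  move/eqP; rewrite -{2}[x]mul1g (can_eq (mulgK x)) => /eqP E.
  by rewrite -(gring_valK i) E eqxx in ni.
have vc : v = c *: const_mx 1.
  apply/rowP=> i; by rewrite !mxE mulr1 -(v_const (enum_val i)) ?enum_valP // gring_valK.
have c0 : c != 0 by apply: contraNneq v0 => c0; rewrite vc c0 scale0r.
by rewrite -(eqmx_scale _ c0) -vc.
Qed.

End RegularRepresentation.

(** * Linear relations among conjugates, and the trace *)

Section ConjugateRelations.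
Import VectorInternalTheory.

Variables (K : fieldType) (L : splittingFieldType K).
Hypothesis galL : galois 1 {:L}.
Local Notation G := 'Gal({:L} / 1)%g.
Implicit Types (rho : L) (s : gal_of {:L}).

Lemma mem_Gal1 s : s \in G.
Proof. by rewrite gal_kHom ?sub1v // k1AHom. Qed.

Lemma card_Gal1 : #|G| = \dim {:L}.
Proof. by rewrite -galois_dim // dimv1 divn1. Qed.

(** Indexing by [enum_val] makes coefficient vectors live in the space of [regular_repr]. *)
Definition conjugate_tuple rho : #|G|.-tuple L :=
  [tuple (enum_val i : gal_of {:L}) rho | i < #|G|].

Lemma galois_conjugatesE rho : galois_conjugates rho = conjugate_tuple rho.
Proof.
apply: (@eq_from_nth _ 0); first by rewrite [RHS]size_tuple size_map -cardE.
move=> i; rewrite size_map -cardE => ltiG; rewrite (nth_map 1%g) -?cardE //.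
rewrite (nth_map (Ordinal ltiG)) ?size_enum_ord //.
by rewrite (nth_ord_enum _ (Ordinal ltiG)) (enum_val_nth 1%g).
Qed.

Lemma sum_conjugates (k : 'I_#|G| -> K) rho :
  \sum_i k i *: (conjugate_tuple rho)`_i
    = \sum_i k i *: (enum_val i : gal_of {:L}) rho.
Proof. by apply: eq_bigr => i _; rewrite -tnth_nth tnth_mktuple. Qed.

Lemma free_conjugates_generate rho : free (conjugate_tuple rho) ->
  generates_KG rho /\ normal_basis_generator rho.
Proof.
move=> fr; have bas : basis_of {:L} (conjugate_tuple rho).
  by rewrite basisEfree fr subvf size_tuple card_Gal1 /=.
split; last by rewrite /normal_basis_generator galois_conjugatesE.
move=> y; exists [ffun s => coord (conjugate_tuple rho) (gring_index G s) y].
rewrite {1}(coord_basis bas (memvf y)) sum_conjugates /group_algebra_act.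
by rewrite [RHS]big_enum_val; apply: eq_bigr => i _; rewrite ffunE gring_valK.
Qed.

(** If the conjugates spanned L, their number would make them a basis, against the relation. So some
    y lies outside their span, which contains the whole orbit. *)
Lemma conjugate_relation_not_generating rho (a : gal_of {:L} -> K) s :
  a s != 0 -> \sum_(t in G) a t *: (t : gal_of {:L}) rho = 0 ->
  exists y, ~ in_KG_orbit rho y.
Proof.
move=> as0 rel; have [full|/subvPn[y _ nspan]] := boolP ({:L} <= <<conjugate_tuple rho>>)%VS.
  have fr : free (conjugate_tuple rho).
    have := dim_span (conjugate_tuple rho); rewrite size_tuple => le_span.
    rewrite /free size_tuple eqn_leq le_span /=.
    by apply: leq_trans (dimvS full); rewrite card_Gal1.
  move: rel; rewrite big_enum_val -(sum_conjugates (fun i => a (enum_val i))).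
  move/freeP: fr => fr /fr/(_ (gring_index G s)).
  by rewrite gring_indexK ?mem_Gal1 // => E; rewrite E eqxx in as0.
exists y => -[b yb]; case/negP: nspan; rewrite yb rpred_sum // => t _.
apply/rpredZ/memv_span; rewrite -galois_conjugatesE.
by apply/mapP; exists t; rewrite ?mem_enum ?mem_Gal1.
Qed.

Lemma trace_eq0_not_generating rho : galTrace 1 {:L} rho = 0 ->
  exists y, ~ in_KG_orbit rho y.
Proof.
move=> tr0; apply: (@conjugate_relation_not_generating _ (fun=> 1) 1%g) (oner_neq0 _) _.
by under eq_bigr do rewrite scale1r.
Qed.

(** The relations among the conjugates form a submodule of the regular representation. If nonzero,
    it contains the all-ones vector, which is the relation that the trace vanishes. *)
Lemma trace_neq0_generates p rho : p \in [pchar K] -> (p.-group G)%g ->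
  galTrace 1 {:L} rho != 0 ->
  generates_KG rho /\ normal_basis_generator rho.
Proof.
move=> charK pG tr0; apply: free_conjugates_generate; apply/freeP=> k.
rewrite sum_conjugates => rel i; apply/eqP.
pose B := \matrix_(i < #|G|) v2r ((enum_val i : gal_of {:L}) rho).
have mulB (v : 'rV[K]_#|G|) :
    v *m B = v2r (\sum_i v 0 i *: (enum_val i : gal_of {:L}) rho).
  rewrite mulmx_sum_row linear_sum; apply: eq_bigr => j _.
  by rewrite linearZ rowK.
have modB : mxmodule (regular_repr K G) (kermx B).
  apply/mxmoduleP => x Gx; apply/sub_kermxP; rewrite -mulmxA.
  (* Products in [gal_of] apply the left factor first, so right translation by x on coordinates is x
     acting on L. *)
  have -> : regular_repr K G x *m B
            = B *m lin1_mx (v2r \o x \o r2v).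
    apply/row_matrixP=> j; rewrite !row_mul !rowK mul_rV_lin1 /= v2rK.
    by rewrite -rowE rowK gring_indexK ?groupM ?enum_valP // galM ?memvf.
  by rewrite mulmxA mulmx_ker mul0mx.
have [kerB0|/(pgroup_regular_submod charK pG modB)/sub_kermxP] := eqVneq (kermx B) 0.
  have : (\row_j k j <= kermx B)%MS.
    apply/sub_kermxP; rewrite mulB; under eq_bigr do rewrite mxE.
    by rewrite rel linear0.
  by rewrite kerB0 submx0 => /eqP/rowP/(_ i); rewrite !mxE => /eqP.
rewrite mulB; under eq_bigr do rewrite mxE scale1r.
have -> : \sum_(i < #|G|) (enum_val i : gal_of {:L}) rho = galTrace 1 {:L} rho.
  exact/esym/big_enum_val.
by move/eqP; rewrite -(linear0 v2r) (can_eq v2rK) (negPf tr0).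
Qed.

End ConjugateRelations.

(** * Euler's trace formula for pi^j / f'(pi) *)

Section EulerTrace.
Variables (K : fieldType) (L : splittingFieldType K).
Variables (vK : discrete_valuation K) (vL : discrete_valuation L).
Hypothesis (galL : galois 1 {:L}) (ramL : fully_ramified vK vL).
Variables (pi : L) (pi_unif : uniformizer vL pi).
Local Notation f := (minPoly 1 pi).
Let N := \dim {:L}.

Lemma galTraceE (x : L) : galTrace 1 {:L} x = \sum_(s : gal_of {:L}) s x.
Proof. by apply: eq_bigl => s; rewrite mem_Gal1. Qed.

Lemma galTraceZ (a : K) (x : L) :
  galTrace 1 {:L} (a *: x) = a *: galTrace 1 {:L} x.
Proof. by rewrite /galTrace scaler_sumr; apply: eq_bigr => s _; rewrite linearZ. Qed.

Lemma card_gal_of : #|{: gal_of {:L}}| = N.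
Proof. by rewrite /N -(card_Gal1 galL); apply: eq_card => s; rewrite mem_Gal1. Qed.

Lemma gal_unif_inj : injective (fun s : gal_of {:L} => s pi).
Proof.
move=> s t st; apply/eqP/gal_eqP => x _.
have [a ->] := fully_ramified_power_sum ramL pi_unif x.
rewrite !linear_sum; apply: eq_bigr => i _; rewrite !linearZ /= !rmorphXn.
by congr (_ *: _ ^+ _).
Qed.

(** The N conjugates of pi are distinct because the powers of pi span L; all are roots of f, whose
    degree is at most N. *)
Lemma minPoly_unifE : f = \prod_(s : gal_of {:L}) ('X - (s pi)%:P).
Proof.
rewrite -big_enum /=.
pose rs := [seq (s : gal_of {:L}) pi | s <- enum {: gal_of {:L}}].
have hE : \prod_(s <- enum {: gal_of {:L}}) ('X - ((s : gal_of {:L}) pi)%:P)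
    = \prod_(z <- rs) ('X - z%:P).
  by rewrite /rs big_map.
have rs_f : all (root f) rs.
  by apply/allP => _ /mapP[s _ ->]; rewrite (root_minPoly_gal (sub1v _)) ?memvf ?mem_Gal1.
have rs_uniq : uniq_roots rs.
  by rewrite uniq_rootsE map_inj_uniq ?enum_uniq //; apply: gal_unif_inj.
have dvd := uniq_roots_dvdp rs_f rs_uniq.
have sz : size (\prod_(z <- rs) ('X - z%:P)) = N.+1.
  by rewrite size_prod_XsubC size_map -cardE card_gal_of.
have f0 : f != 0 by rewrite monic_neq0 ?monic_minPoly.
have le_f : (size f <= N.+1)%N.
  rewrite size_minPoly ltnS; have := dim_Fadjoin 1 pi; rewrite dimv1 muln1 => <-.
  exact/dimvS/subvf.
rewrite hE; apply/esym/eqP; rewrite -eqp_monic ?monic_minPoly ?monic_prod_XsubC //.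
by rewrite -dvdp_size_eqp // eqn_leq dvdp_leq //= sz.
Qed.

Lemma horner_deriv_minPoly (s : gal_of {:L}) :
  f^`().[s pi] = \prod_(t | t != s) (s pi - t pi).
Proof.
rewrite minPoly_unifE (bigD1 s) //= derivM derivXsubC mul1r !hornerE subrr mul0r addr0.
by rewrite horner_prod; apply: eq_bigr => t _; rewrite !hornerE.
Qed.

Lemma gal_deriv_minPoly (s : gal_of {:L}) : s f^`().[pi] = f^`().[s pi].
Proof.
rewrite -horner_map -deriv_map; congr (_^`().[_]).
by rewrite (fixedPoly_gal (sub1v _) (mem_Gal1 s)) ?minPolyOver.
Qed.

Lemma deriv_minPoly_neq0 : f^`().[pi] != 0.
Proof.
rewrite -{2}(gal_id {:L} pi) horner_deriv_minPoly.
apply/prodf_neq0 => t nt; rewrite subr_eq0; apply: contraNneq nt => /gal_unif_inj E.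
by rewrite E.
Qed.

(* Euler: Lagrange interpolation of 'X^j at the conjugates of pi; the trace is
   the coefficient of degree N - 1. *)
Lemma trace_power_deriv (j : nat) : (j < N)%N ->
  galTrace 1 {:L} (pi ^+ j / f^`().[pi]) = (j == N.-1)%:R.
Proof.
move=> ltjN; set c := _ / _.
have N0 : (0 < N)%N by apply: leq_trans ltjN.
pose h (s : gal_of {:L}) := \prod_(t | t != s) ('X - ((t : gal_of {:L}) pi)%:P).
have sz_h s : size (h s) = N.
  have -> : h s = \prod_(t <- enum (predC1 s)) ('X - (t pi)%:P) by rewrite big_enum.
  by rewrite size_prod_XsubC -cardE cardC1 card_gal_of prednK.
pose g := \sum_(s : gal_of {:L}) (s c) *: h s.
have gX : g = 'X^j.
  (* The difference has degree below N and vanishes at the N conjugates: at [s pi] only the term of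
     index s survives, with value s(c f'(pi)) = (s pi)^j. *)
  apply/eqP; rewrite -subr_eq0.
  pose rs := [seq (s : gal_of {:L}) pi | s <- enum {: gal_of {:L}}].
  apply/eqP/(@roots_geq_poly_eq0 _ _ rs).
  - apply/allP => _ /mapP[s _ ->]; rewrite rootE hornerD hornerN hornerXn horner_sum.
    rewrite (bigD1 s) //= big1 => [|t nt].
      rewrite addr0 hornerZ horner_prod.
      under eq_bigr => t _ do rewrite hornerXsubC.
      rewrite -horner_deriv_minPoly -gal_deriv_minPoly -rmorphM.
      by rewrite divfK ?deriv_minPoly_neq0 // rmorphXn subrr.
    by rewrite hornerZ horner_prod (bigD1 s) ?(eq_sym s) //= hornerXsubC subrr mul0r mulr0.
  - by rewrite map_inj_uniq ?enum_uniq //; apply: gal_unif_inj.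
  - rewrite size_map -cardE card_gal_of (leq_trans (size_polyD _ _)) // geq_max.
    rewrite size_polyN size_polyXn ltjN andbT (leq_trans (size_sum _ _ _)) //.
    by apply/bigmax_leqP => s _; rewrite (leq_trans (size_scale_leq _ _)) ?sz_h.
have : g`_(N.-1) = galTrace 1 {:L} c.
  rewrite coef_sum galTraceE; apply: eq_bigr => s _.
  rewrite coefZ -{1}(sz_h s) -/(lead_coef _) (monicP (monic_prod_XsubC _ _ _)).
  by rewrite mulr1.
by move=> <-; rewrite gX coefXn eq_sym.
Qed.

End EulerTrace.

(** Used with x = v(rho), y = v(f'(pi)) and l the dominant index of rho f'(pi). The equations give n
    (q - z) = l + 1, which lies in [1, n], so q - z = 1. *)
Lemma last_residue (n l : nat) (x y z q : int) :
  x + y = n%:Z * z + l%:Z -> x - (- y - 1) = q * n%:Z -> (l < n)%N -> l = n.-1.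
Proof.
move=> xy xyq ltln; have E : n%:Z * (q - z) = l%:Z + 1 by rewrite mulrBr; lia.
have q_gt0 : 0 < q - z by nia.
have q_lt2 : q - z < 2 by nia.
have q1 : q - z = 1 by lia.
by move: E; rewrite q1; lia.
Qed.

(** * Valuation classes and vanishing of the trace *)

Section FullyRamifiedCriterion.
Variables (K : fieldType) (L : splittingFieldType K).
Variables (vK : discrete_valuation K) (vL : discrete_valuation L).
Hypothesis (galL : galois 1 {:L}) (ramL : fully_ramified vK vL).
Variables (pi : L) (pi_unif : uniformizer vL pi).
Let N := \dim {:L}.
Let d := (minPoly 1 pi)^`().[pi].
Let N_gt0 : (0 < N)%N. Proof. exact: adim_gt0. Qed.
Let d0 : d != 0 := deriv_minPoly_neq0 galL ramL pi_unif.

(** By Euler's formula the trace is the coefficient of index N - 1 of rho f'(pi). The congruence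
    makes that term dominant, so its coefficient is nonzero. *)
Lemma trace_neq0_valuation (rho : L) : rho != 0 ->
  (vL rho = - vL d - 1 %[mod N])%Z -> galTrace 1 {:L} rho != 0.
Proof.
move=> rho0 /eqP; rewrite eqz_mod_dvd => /dvdzP[q vq].
have [a aE] := fully_ramified_power_sum ramL pi_unif (rho * d).
have [i ai0] : exists i, a i != 0.
  apply/existsP; rewrite -negb_forall; apply/negP => /forallP a0.
  have /eqP : rho * d = 0.
    by rewrite aE big1 // => i _; rewrite (eqP (a0 i)) scale0r.
  by rewrite mulf_eq0 (negPf rho0) (negPf d0).
have [l [al _ vl _]] := dval_power_sum ramL pi_unif ai0.
have lN : l = N.-1 :> nat.
  by rewrite -aE dvalM // in vl; apply: last_residue vl vq (ltn_ord l).
have -> : rho = \sum_i a i *: (pi ^+ i / d).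
  by under eq_bigr do rewrite scalerAl; rewrite -mulr_suml -aE mulfK.
rewrite raddf_sum (bigD1 l) //= big1 => [|j nj].
  rewrite addr0 galTraceZ (trace_power_deriv galL ramL pi_unif) ?ltn_ord //.
  by rewrite lN eqxx algK_neq0.
rewrite galTraceZ (trace_power_deriv galL ramL pi_unif) ?ltn_ord // -lN.
by rewrite val_eqE (negPf nj) scaler0.
Qed.

(** A K-multiple of pi^j / f'(pi) works, with j the residue of i + v(f'(pi)) modulo N; the excluded
    class is exactly j = N - 1. *)
Lemma trace_eq0_valuation (i : int) : (i <> - vL d - 1 %[mod N])%Z ->
  exists rho : L, [/\ rho != 0, vL rho = i & galTrace 1 {:L} rho = 0].
Proof.
move=> /eqP ni; rewrite eqz_mod_dvd in ni.
have Np : 0 < N%:Z by lia.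
have Nn : N%:Z != 0 by lia.
pose j := absz ((i + vL d) %% N)%Z.
have jE : j%:Z = ((i + vL d) %% N)%Z by rewrite gez0_abs // modz_ge0.
have ltj : (j < N)%N by have := ltz_pmod (i + vL d) Np; lia.
have iE := divz_eq (i + vL d) N; rewrite -jE in iE.
have [a a0 va] := dval_surj vK ((i + vL d) %/ N)%Z.
have pj0 := unifX_neq0 pi_unif j.
have rho0 : pi ^+ j / d != 0 by rewrite mulf_neq0 ?invr_eq0.
exists (a *: (pi ^+ j / d)); split; first by rewrite scaler_eq0 negb_or a0.
  rewrite (dvalZ ramL) // dvalM ?invr_eq0 // dvalV // (dval_unifX pi_unif) va.
  by rewrite mulrC -/N; lia.
rewrite galTraceZ (trace_power_deriv galL ramL pi_unif) //.
rewrite (_ : j == N.-1 = false) ?scaler0 //.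
apply/negP => /eqP jN; case/negP: ni; apply/dvdzP.
exists (((i + vL d) %/ N)%Z + 1); rewrite mulrDl mul1r.
move: iE; rewrite jN; lia.
Qed.

End FullyRamifiedCriterion.

(** * Trace zero elements from a nontrivial residue extension *)

Section ResidueExtension.
Variables (K : fieldType) (L : splittingFieldType K).
Variables (vK : discrete_valuation K) (vL : discrete_valuation L).
Hypothesis (galL : galois 1 {:L}).
Variables (e : nat) (e_gt0 : (0 < e)%N) (ram : ramification_index vK vL e).

(** With t = Tr(u r) / Tr(r), the element (u - t) r has trace 0; a scalar of K brings u - t back to
    valuation 0. *)
Lemma trace_eq0_residue (u : L) (i : int) : vL u = 0 ->
  (forall t : K, ~~ val_ge vL 1 (u - t%:A)) ->
  exists rho : L, [/\ rho != 0, vL rho = i & galTrace 1 {:L} rho = 0].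
Proof.
move=> vu resu.
have u0 : u != 0.
  by have := resu 0; rewrite scale0r subr0; apply: contraNneq => ->; apply: val_ge0.
have [r r0 vr] := dval_surj vL i.
have [tr0|tr0] := eqVneq (galTrace 1 {:L} r) 0; first by exists r.
have [a aE] := vlineP _ _ (mem_galTrace galL (memvf r)).
have [b bE] := vlineP _ _ (mem_galTrace galL (memvf (u * r))).
have a0 : a != 0 by apply: contraNneq tr0 => a0; rewrite aE a0 scale0r.
pose t := b / a.
have ut0 : u - t%:A != 0 by apply: contraNneq (resu t) => ->; apply: val_ge0.
(* If t is integral, u - t is already a unit by the hypothesis on u. Otherwise t dominates u, and
   t^-1 normalizes. *)
have [s s0 vs] : exists2 s : K, s != 0 & vL (s *: (u - t%:A)) = 0.
  have [vt|vt] := boolP (val_ge vK 0 t).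
    exists 1; rewrite ?oner_neq0 // scale1r; apply/eqP; rewrite eq_le.
    have := resu t; rewrite val_ge_neq0 // -ltNge => lt1.
    have ge0 : val_ge vL 0 (u - t%:A).
      apply: val_geB; first by rewrite val_ge_neq0 // vu.
      by have := val_ge_alg ram vt; rewrite mulr0.
    by rewrite val_ge_neq0 // in ge0; rewrite ge0 andbT -ltzD1 add0r.
  have t0 : t != 0 by apply: contraNneq vt => ->; apply: val_ge0.
  rewrite val_ge_neq0 // -ltNge in vt.
  exists t^-1; rewrite ?invr_eq0 // (dvalZ ram) ?invr_eq0 // dvalV //.
  have tA0 : - t%:A != 0 :> L by rewrite oppr_eq0 algK_neq0.
  have vtA : vL (- t%:A) = e%:Z * vK t by rewrite dvalN ?algK_neq0 // ram.
  have vuA : val_ge vL (vL (- t%:A) + 1) u by rewrite val_ge_neq0 // vu vtA; nia.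
  have [_] := dvalDl tA0 vuA.
  by rewrite [u - _]addrC => ->; rewrite vtA mulrN addNr.
exists (s *: (u - t%:A) * r); split.
- by rewrite mulf_neq0 // scaler_eq0 negb_or s0.
- by rewrite dvalM ?scaler_eq0 ?negb_or ?s0 // vs add0r.
rewrite -scalerAl galTraceZ mulrBl mulr_algl raddfB /= galTraceZ aE bE scalerA divfK //.
by rewrite subrr scaler0.
Qed.

End ResidueExtension.

(** * Lifting roots of unity from the residue field *)

Section RootsOfUnity.
Variables (K : fieldType) (v : discrete_valuation K).
Hypothesis K_complete : val_complete v.
Variables (p : nat) (charKp : p \in [pchar K]).

Lemma exprB_pchar_pow k (x y : K) : (x - y) ^+ (p ^ k) = x ^+ (p ^ k) - y ^+ (p ^ k).
Proof.
have pk : [pchar K].-nat (p ^ k)%N by rewrite pnatX pnatE ?charKp // (pcharf_prime charKp).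
by rewrite exprDn_pchar // exprNn_pchar.
Qed.

Lemma val_ge_subXX m n (x y : K) : val_ge v 0 x -> val_ge v 0 y ->
  val_ge v m (x - y) -> val_ge v m (x ^+ n - y ^+ n).
Proof.
move=> x0 y0 xy; rewrite subrXX -[m]addr0; apply: val_geM => //.
apply: val_ge_sum => i _; rewrite -[0](addr0 0).
by apply: val_geM; apply: val_ge0X.
Qed.

(* The Teichmueller representative: the limit of [a ^+ (P ^ t)], where
   [P] is a power of p congruent to 1 modulo q. *)
Lemma lift_root_of_unity (q : nat) (a : K) : coprime p q -> (0 < q)%N ->
  val_ge v 0 a -> val_ge v 1 (a ^+ q - 1) ->
  exists z : K, z ^+ q = 1 /\ val_ge v 1 (z - a).
Proof.
move=> co_pq q_gt0 va vaq.
have p_gt1 : (1 < p)%N := prime_gt1 (pcharf_prime charKp).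
pose r := totient q; pose P := (p ^ r)%N.
have P_gt1 : (1 < P)%N by rewrite -[1%N](exp1n r) ltn_exp2r ?totient_gt0.
have v1 : val_ge v 0 1 by rewrite val_ge_neq0 ?oner_neq0 // dval1.
(* Euler's theorem gives P - 1 = k q, so a^P - a = (a^(k q) - 1) a. *)
have vaP : val_ge v 1 (a ^+ P - a).
  have /eqP := Euler_exp_totient co_pq; rewrite eqn_mod_dvd ?expn_gt0 ?(ltnW p_gt1) //.
  case/dvdnP => k Pk.
  have -> : a ^+ P - a = (a ^+ (k * q) - 1) * a.
    by rewrite -Pk -/r -/P mulrBl mul1r -exprSr subn1 prednK // ltnW.
  rewrite -[1]addr0; apply: val_geM => //.
  by rewrite mulnC exprM -(expr1n K k); apply: val_ge_subXX => //; apply: val_ge0X.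
have frobP t (x y : K) : (x - y) ^+ (P ^ t) = x ^+ (P ^ t) - y ^+ (P ^ t).
  by rewrite /P -expnM exprB_pchar_pow.
have leP t : (t.+1 <= P ^ t)%N by apply: ltn_expl.
pose u t := a ^+ (P ^ t).
(* Taking P^t-th powers is additive, so consecutive terms differ by (a^P - a)^(P^t), of valuation at
   least P^t >= t + 1. *)
have step i k : val_ge v (i.+1%:Z) (u (i + k)%N - u i).
  elim: k => [|k IH]; first by rewrite addn0 subrr val_ge0.
  rewrite -(subrK (u (i + k)%N) (u (i + k.+1)%N)) -addrA; apply: val_geD => //.
  have -> : u (i + k.+1)%N - u (i + k)%N = (a ^+ P - a) ^+ (P ^ (i + k)).
    by rewrite frobP -exprM -expnS addnS.
  apply: val_ge_trans (val_geX _ vaP).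
  by have := leP (i + k)%N; rewrite -mulr_natr natz mul1r; lia.
have [|z zP] := K_complete (u := u).
  move=> m; exists (absz m) => i j mi mj.
  have mono i' j' : (absz m <= i')%N -> (i' <= j')%N -> val_ge v m (u j' - u i').
    by move=> mi' ij'; have := step i' (j' - i')%N; rewrite subnKC //; apply: val_ge_trans; lia.
  have [ij|/ltnW ji] := leqP i j; last exact: mono.
  by rewrite -opprB; apply/val_geN/mono.
have vza : val_ge v 1 (z - a).
  have [n nP] := zP 1; have := nP n (leqnn n) => vun.
  have -> : z - a = (u n - a) - (u n - z) by rewrite opprB [RHS]addrC addrA subrK.
  apply: val_geB => //; have := step 0%N n; rewrite add0n {2}/u expn0 expr1; exact.
exists z; split=> //.
have vz : val_ge v 0 z.
  by rewrite -(subrK a z); apply: val_geD => //; apply: val_ge_trans vza.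
apply/eqP; rewrite -subr_eq0; apply/eqP/(@val_ge_all_eq0 _ v) => m.
(* The summand n controls the distance to the limit, and |m| controls (a^q - 1)^(P^t). *)
have [n nP] := zP m; pose t := (n + absz m)%N.
have -> : z ^+ q - 1 = (z ^+ q - u t ^+ q) + (u t ^+ q - 1) by rewrite addrA subrK.
apply: val_geD.
  rewrite -opprB; apply/val_geN/val_ge_subXX => //; first exact: val_ge0X.
  by apply: nP; rewrite leq_addr.
have -> : u t ^+ q - 1 = (a ^+ q - 1) ^+ (P ^ t).
  by rewrite frobP expr1n /u exprAC.
apply: val_ge_trans (val_geX _ vaq).
by have := leP t; rewrite -mulr_natr natz mul1r /t; lia.
Qed.

End RootsOfUnity.

(** * Eigenvectors of automorphisms of prime order q other than p *)

Section TameConjugation.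
Variables (K : fieldType) (L : splittingFieldType K).
Variables (vK : discrete_valuation K) (vL : discrete_valuation L).
Hypothesis (ramL : fully_ramified vK vL).
Variables (pi : L) (pi_unif : uniformizer vL pi).
Variables (p : nat) (charKp : p \in [pchar K]) (K_complete : val_complete vK).

(** Multiplicativity of the tame character, the residue of [s pi / pi]: s fixes z and preserves
    valuations. *)
Lemma val_ge_iter_conj (s : gal_of {:L}) (z : K) :
  val_ge vK 0 z -> val_ge vL 2 (s pi - z *: pi) ->
  forall j, val_ge vL 2 ((s ^+ j)%g pi - z ^+ j *: pi).
Proof.
move=> vz vs; elim=> [|j IH]; first by rewrite gal_id scale1r subrr val_ge0.
have -> : (s ^+ j.+1)%g pi - z ^+ j.+1 *: pi
   = s ((s ^+ j)%g pi - z ^+ j *: pi) + (z ^+ j)%:A * (s pi - z *: pi).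
  have sZ : s (z ^+ j *: pi) = z ^+ j *: s pi by rewrite linearZ.
  rewrite expgSr galM ?memvf // linearB /= sZ mulr_algl scalerBr scalerA -exprSr.
  by rewrite addrA subrK.
apply: val_geD; first exact: (val_ge_conj ramL pi_unif).
rewrite -[2](add0r 2); apply: val_geM => //.
by have := val_ge_alg ramL (val_ge0X j vz); rewrite mulr0.
Qed.

(** The tame character of s is a q-th root of unity in the residue field and lifts to z in K. The
    resolvent of pi for z is an eigenvector, congruent to q pi modulo valuation 2, and q is a unit
    since it differs from p. *)
Lemma tame_eigenvector (q : nat) (s : gal_of {:L}) :
  prime q -> q != p -> #[s]%g = q ->
  exists z : K, exists2 w : L, s w = z *: w & w != 0 /\ vL w = 1.
Proof.
move=> q_pr q_neq_p os; have [pi0 vpi] := pi_unif.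
have p_pr := pcharf_prime charKp; have q_gt0 := prime_gt0 q_pr.
have spi0 : s pi != 0 by rewrite fmorph_eq0.
have vspi : vL (s pi) = 1 by rewrite (dval_conj ramL pi_unif).
have vq : val_ge vL 0 (s pi / pi).
  by rewrite val_ge_neq0 ?mulf_neq0 ?invr_eq0 // dvalM ?invr_eq0 // dvalV // vspi vpi subrr.
have [a va1] := fully_ramified_residue ramL pi_unif vq.
have vN_ge m (x : K) : val_ge vL m (x%:A : L) -> m <= 1 -> 0 <= m -> val_ge vK m x.
  have [->|x0] := eqVneq x 0; first by rewrite val_ge0.
  rewrite !val_ge_neq0 ?algK_neq0 // ramL // => mN m1 m0.
  have : (0 < \dim {:L})%N by apply: adim_gt0.
  by move: (\dim _) mN => n; nia.
have va : val_ge vK 0 a.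
  apply: vN_ge => //; rewrite -[a%:A](subKr (s pi / pi)); apply: val_geB => //.
  exact: val_ge_trans va1.
have va2 : val_ge vL 2 (s pi - a *: pi).
  have -> : s pi - a *: pi = (s pi / pi - a%:A) * pi by rewrite mulrBl divfK // mulr_algl.
  by rewrite -[2]/(1 + 1 : int); apply: val_geM => //; rewrite val_ge_neq0 // vpi.
(* Since s^q = 1, iterating q times shows that (a^q - 1) pi has valuation at least 2. *)
have vaq : val_ge vK 1 (a ^+ q - 1).
  apply: vN_ge => //; have := val_ge_iter_conj va va2 q.
  rewrite -os expg_order gal_id => /val_geN; rewrite opprB => v2.
  have -> : (a ^+ #[s]%g - 1)%:A = (a ^+ #[s]%g *: pi - pi) * pi^-1 :> L.
    by rewrite mulrBl divff // scalerBl scale1r -scalerAl divff.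
  rewrite -[1]/(2 - 1 : int); apply: val_geM => //.
  by rewrite val_ge_neq0 ?invr_eq0 // dvalV // vpi.
have co_pq : coprime p q by rewrite prime_coprime // dvdn_prime2 // eq_sym.
have [z [zq vza]] := lift_root_of_unity K_complete charKp co_pq q_gt0 va vaq.
have vz : val_ge vK 0 z.
  by rewrite -(subrK a z); apply: val_geD => //; apply: val_ge_trans vza.
have z0 : z != 0 by apply: contra_eq_neq zq => ->; rewrite expr0n gtn_eqF // eq_sym oner_neq0.
have vz2 : val_ge vL 2 (s pi - z *: pi).
  have -> : s pi - z *: pi = (s pi - a *: pi) - (z - a)%:A * pi.
    by rewrite mulr_algl scalerBl opprB addrA subrK.
  apply: val_geB => //; rewrite -[2]/(1 + 1 : int); apply: val_geM.
    apply: val_ge_trans (val_ge_alg ramL vza); rewrite mulr1.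
    by have : (0 < \dim {:L})%N by [apply: adim_gt0]; lia.
  by rewrite val_ge_neq0 // vpi.
have vit := val_ge_iter_conj vz vz2.
pose E j := z ^- j *: (s ^+ j)%g pi.
pose w := \sum_(j < q) E j.
exists z; exists w.
  have sE j : s (E j) = z *: E j.+1.
    rewrite linearZ /= -galM ?memvf // -expgSr scalerA; congr (_ *: _).
    by rewrite exprS invfM mulVKf.
  have -> : s w = \sum_(j < q) z *: E j.+1.
    by rewrite linear_sum; apply: eq_bigr => j _; apply: sE.
  rewrite -scaler_sumr; congr (_ *: _).
  have Eq : E q = E 0%N by rewrite /E -{2}os expg_order zq expr0.
  by rewrite /w -(prednK q_gt0) big_ord_recr [RHS]big_ord_recl /= prednK // Eq addrC.
have vzj j : val_ge vL 0 ((z ^- j)%:A : L).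
  have vz' : val_ge vK 0 z^-1.
    have -> : z^-1 = z ^+ q.-1.
      by apply: (mulfI z0); rewrite divff // -exprS prednK.
    exact: val_ge0X.
  by rewrite -exprVn; have := val_ge_alg ramL (val_ge0X j vz'); rewrite mulr0.
have qK : q%:R != 0 :> K by rewrite -(dvdn_pcharf charKp) dvdn_prime2 // eq_sym.
(* By Fermat, the image of q in K is a root of unity. *)
have vq0 : vK q%:R = 0.
  have co_qp : coprime q p by rewrite coprime_sym.
  have := congr1 (fun n => n%:R : K) (Euler_exp_totient co_qp).
  rewrite /= !(GRing.natr_mod_pchar charKp) natrX => /(congr1 vK).
  rewrite dval1 dvalX // => /eqP; rewrite mulrn_eq0 => /orP[|/eqP //].
  by rewrite -leqn0 leqNgt totient_gt0 prime_gt0.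
have vqpi : vL (q%:R *: pi) = 1 by rewrite (dvalZ ramL) // vq0 mulr0 vpi.
have qpi0 : q%:R *: pi != 0 by rewrite scaler_eq0 negb_or qK.
suff vw : val_ge vL (vL (q%:R *: pi) + 1) (w - q%:R *: pi).
  by have := dvalDl qpi0 vw; rewrite addrC subrK vqpi.
rewrite vqpi scaler_nat -[q in _ *+ q]card_ord -sumr_const -sumrB.
apply: val_ge_sum => j _.
have -> : E j - pi = (z ^- j)%:A * ((s ^+ j)%g pi - z ^+ j *: pi).
  by rewrite mulr_algl scalerBr scalerA mulVf ?scale1r // expf_neq0.
by rewrite -[1 + 1]/(0 + 2 : int); apply: val_geM.
Qed.

End TameConjugation.

(** * Failure of the criterion outside totally ramified p-power degree *)

Section NotGenerating.
Variables (p : nat) (K : fieldType) (charKp : p \in [pchar K]).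
Variables (vK : discrete_valuation K) (K_complete : val_complete vK).
Variables (L : splittingFieldType K) (galL : galois 1 {:L}).
Variables (vL : discrete_valuation L).
Variables (pi : L) (pi_unif : uniformizer vL pi).

Lemma tame_not_generating : fully_ramified vK vL ->
  (forall n, \dim {:L} <> (p ^ n)%N) ->
  forall i : int, exists rho : L,
    [/\ rho != 0, vL rho = i & exists y : L, ~ in_KG_orbit rho y].
Proof.
move=> ramL notp i.
have p_pr := pcharf_prime charKp.
have [q q_pr [q_neq_p q_dvd]] : exists2 q, prime q & q != p /\ (q %| \dim {:L})%N.
  have : ~~ p.-nat (\dim {:L}) by apply/negP => /p_natP[n /notp].
  rewrite /pnat adim_gt0 /= => /allPn[q]; rewrite mem_primes => /and3P[q_pr _ q_dvd].
  by rewrite !inE => q_neq_p; exists q.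
rewrite -(card_Gal1 galL) in q_dvd; have [s _ os] := Cauchy q_pr q_dvd.
have [z [w sw [w0 vw]]] :=
  tame_eigenvector ramL pi_unif charKp K_complete q_pr q_neq_p os.
have s1 : s != 1%g.
  by apply: contraTneq q_pr => s1; rewrite -os s1 order1.
exists (w ^ i); split; first exact: expfz_neq0.
  by rewrite dvalXz // vw mul1r.
(* The coefficients of s - z^i in K[G]; this annihilates w^i because s w = z w with z in K. *)
pose a (t : gal_of {:L}) : K := if t == s then 1 else if t == 1%g then - z ^ i else 0.
apply: (conjugate_relation_not_generating galL (a := a) (s := s)).
  by rewrite /a eqxx oner_neq0.
rewrite (bigD1 s) ?mem_Gal1 //= (bigD1 1%g) /= ?group1 1?eq_sym //.
rewrite big1 => [|t /andP[/andP[_ ts] t1]]; last first.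
  by rewrite /a (negPf ts) (negPf t1) scale0r.
rewrite addr0 /a eqxx eq_sym (negPf s1) eqxx scale1r gal_id.
have -> : s (w ^ i) = z ^ i *: w ^ i.
  by rewrite fmorphXz /= sw -mulr_algl expfzMl -in_algE -fmorphXz /= mulr_algl.
by rewrite scaleNr subrr.
Qed.

(** By contraposition: if no such rho exists, every unit is approximated by an element of K, so the
    powers of pi span L and N <= e. *)
Lemma residue_not_generating (e : nat) : (0 < e)%N ->
  ramification_index vK vL e -> e <> \dim {:L} ->
  forall i : int, exists rho : L,
    [/\ rho != 0, vL rho = i & exists y : L, ~ in_KG_orbit rho y].
Proof.
move=> e_gt0 ram e_neq i; apply: NNPP => no_rho; apply: e_neq; apply/eqP.
rewrite eqn_leq (ramification_le_dim ram pi_unif) /=.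
apply: (dim_le_ramification (pi := pi)) => x.
apply: (power_sum_complete K_complete e_gt0 ram pi_unif) => u vu.
apply: NNPP => no_t; apply: no_rho.
have [|rho [rho0 vrho tr0]] := trace_eq0_residue galL e_gt0 ram i vu.
  by move=> t; apply/negP => vt; apply: no_t; exists t.
by exists rho; split=> //; apply: trace_eq0_not_generating.
Qed.

End NotGenerating.

Theorem mainTheorem1 (p : nat) (K : fieldType) (charKp : p \in [pchar K])
  (vK : discrete_valuation K) (K_complete : val_complete vK)
  (k_perfect : perfect_field (residue_field vK))
  (L : splittingFieldType K) (L_galois : galois 1 {:L})
  (vL : discrete_valuation L) (vL_extends : val_extends vK vL)
  (piL : L) (piL_unif : uniformizer vL piL) :
  let f := minPoly 1 piL in
  let c := - vL (f^`()).[piL] - 1 in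
  let N := (\dim {:L})%:Z in
  (forall n : nat, fully_ramified vK vL -> \dim {:L} = (p ^ n)%N ->
    forall rho : L, rho != 0 -> (vL rho = c %[mod N])%Z ->
      generates_KG rho /\ normal_basis_generator rho)
  /\
  (~ (fully_ramified vK vL /\ exists n : nat, \dim {:L} = (p ^ n)%N) ->
    forall i : int, exists rho : L,
      [/\ rho != 0, vL rho = i & exists y : L, ~ in_KG_orbit rho y])
  /\
  (forall n : nat, fully_ramified vK vL -> \dim {:L} = (p ^ n)%N ->
    forall i : int, (i <> c %[mod N])%Z -> exists rho : L,
      [/\ rho != 0, vL rho = i & exists y : L, ~ in_KG_orbit rho y]).
Proof.
move=> f c N; split=> [n ramL dimL rho rho0 vrho|].
  apply: (trace_neq0_generates L_galois charKp).
    by rewrite /pgroup (card_Gal1 L_galois) dimL pnatX pnat_id ?(pcharf_prime charKp).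
  exact: (trace_neq0_valuation L_galois ramL piL_unif).
split=> [notram i|n ramL dimL i ni].
  have [e e_gt0 ram] := vL_extends.
  have [eN|/eqP eN] := eqVneq e (\dim {:L}).
    have ramL : fully_ramified vK vL by rewrite /fully_ramified -eN.
    apply: (tame_not_generating charKp K_complete L_galois piL_unif ramL) => n dimL.
    by apply: notram; split=> //; exists n.
  exact: (residue_not_generating K_complete L_galois piL_unif e_gt0 ram eN).
have [rho [rho0 vrho tr0]] := trace_eq0_valuation L_galois ramL piL_unif ni.
by exists rho; split=> //; apply: trace_eq0_not_generating.
Qed.
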